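(* For every integer $p\ge 1$, $$-2\sum_{n=0}^{\infty} \frac{\zeta(2n)}{(2n+p)16^n} = \frac{1}{2}\log 2+\frac{1}{2}\sum_{k=1}^{\lfloor p/2\rfloor} \frac{p!\,(-1)^k(4^k-1)\,\zeta(2k+1)}{(p-2k)!\,(2\pi)^{2k}} - \frac{\pi}{2} \sum_{k=1}^{\lfloor\frac{p+1}{2}\rfloor} \frac{p!\,(-4)^k\beta(2k)}{(p+1-2k)!\,\pi^{2k}}+\delta_{\lfloor \frac{p}{2} \rfloor, \frac{p}{2}}\frac{p!\,(-1)^{\frac{p}{2}}2^p\,\zeta(p+1)}{\pi^p}.$$
   Context: $\zeta$ is the Riemann zeta function, with $\zeta(0)=-\tfrac12$. $\beta(s)=\sum_{n=0}^\infty \frac{(-1)^n}{(2n+1)^s}$ is the Dirichlet beta function. $\delta_{a,b}$ is the Kronecker delta, so $\delta_{\lfloor n/2\rfloor,n/2}$ is $1$ if $n$ is even and $0$ if $n$ is odd; a term multiplied by it is read as $0$ when $n$ is odd. Empty sums are $0$. *)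

(* Defs.v *)
From Stdlib Require Import Reals Arith.
From Coquelicot Require Import Coquelicot.
Open Scope R_scope.

(* The Riemann zeta function at the natural numbers s <> 1: its Dirichlet
   series sum_{n >= 1} 1/n^s converges for s >= 2, and zeta(0) = -1/2 is the
   value of the analytic continuation.  At the pole s = 1 the value is
   meaningless. *)
Definition zeta (s : nat) : R :=
  match s with
  | O => - (1 / 2)
  | _ => Series (fun n : nat => 1 / INR (n + 1) ^ s)
  end.

(* The Dirichlet beta function at the integers s >= 1, where its defining
   series converges. *)
Definition beta (s : nat) : R :=
  Series (fun n : nat => (-1) ^ n / INR (2 * n + 1) ^ s).

(* Main.v *)
Require Import Defs.
From Stdlib Require Import Reals Arith Lra Lia.
From Coquelicot Require Import Coquelicot.
Open Scope R_scope.

(** Both sides equal the integral of [u ^ (p - 1) * C (u / 4)] over [[0, 1]],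
    where [C x] is [PI * x * cot (PI * x)] ([cot_moment], with [q = p - 1]).

    For the left side, [C x] is the power series [-2 * sum zeta (2 n) x ^ (2 n)].
    This comes from the partial fractions of the cotangent ([cot_expansion]) by
    expanding each fraction into a geometric series.  No interchange of infinite
    sums is needed: the error after [N] terms is itself an explicit series
    ([is_series_zeta_remainder]), at most [(1 / 16) ^ N] for [x <= 1 / 4], so
    integrating the partial sums gives the value at once
    ([is_series_zeta_moment]).

    For the right side, the finite identity [Dirichlet_sin] writes [cot] as a sum
    of sines up to an oscillating term that the Riemann-Lebesgue lemma removes, so
    the integral is [PI / 2] times the sum over [k >= 1] of the integrals of
    [u ^ p * sin (PI * k * u / 2)] ([is_lim_seq_sine_moments]).  Integration by
    parts evaluates these in closed form ([is_RInt_sine_moment]).  At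
    [PI * k / 2] the sine vanishes for [k] even and the cosine for [k] odd, so
    adding the terms [k = 2 m + 1] and [k = 2 m + 2] together produces the beta
    values from the sines, and from the cosines the alternating zeta series, that
    is [ln 2] and the values [zeta (2 k + 1)].  The constant terms of the closed
    form, present for even [p], give [zeta (p + 1)].

    The partial fractions of the cotangent rest on the Riemann-Lebesgue lemma
    too, applied to the Fourier coefficients of [cos (x * (PI - t))]. *)

(** * C1 functions and the cardinal sine *)

(** The derivative is a two-sided one at the end points as well, so that the
    rules for [is_derive] apply on the whole segment. *)
Definition C1_on (a b : R) (f : R -> R) : Prop :=
  exists f' : R -> R, forall t, a <= t <= b -> is_derive f t (f' t) /\ continuous f' t.

Lemma C1_on_continuous a b f t : C1_on a b f -> a <= t <= b -> continuous f t.
Proof.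
intros [f' H] Ht. destruct (H t Ht) as [H1 _].
apply (ex_derive_continuous f t). now exists (f' t).
Qed.

Lemma C1_on_mult a b f g : C1_on a b f -> C1_on a b g -> C1_on a b (fun t => f t * g t).
Proof.
intros [f' Hf] [g' Hg].
exists (fun t => f' t * g t + f t * g' t). intros t Ht.
destruct (Hf t Ht) as [f1 f2], (Hg t Ht) as [g1 g2]. split.
- apply (is_derive_mult f g t (f' t) (g' t) f1 g1). intros; apply Rmult_comm.
- assert (cf := C1_on_continuous a b f t (ex_intro _ f' Hf) Ht).
  assert (cg := C1_on_continuous a b g t (ex_intro _ g' Hg) Ht).
  apply (continuous_plus (fun t => f' t * g t) (fun t => f t * g' t) t).
  + now apply (continuous_mult f' g).
  + now apply (continuous_mult f g').
Qed.

Lemma C1_on_inv a b f : C1_on a b f -> (forall t, a <= t <= b -> f t <> 0) -> C1_on a b (fun t => / f t).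
Proof.
intros Hf0 Hn. assert (Hf := Hf0). destruct Hf as [f' Hf].
exists (fun t => - (f' t) / f t ^ 2). intros t Ht.
destruct (Hf t Ht) as [f1 f2]. split.
- now apply is_derive_inv; [|apply Hn].
- assert (cf := C1_on_continuous a b f t Hf0 Ht).
  apply (continuous_mult (fun t => - f' t) (fun t => / f t ^ 2)).
  + now apply (continuous_opp f').
  + apply continuous_Rinv_comp.
    * apply (continuous_mult f (fun t => f t * 1)); [easy|].
      apply (continuous_mult f (fun _ => 1)); [easy|apply continuous_const].
    * now apply pow_nonzero, Hn.
Qed.

Lemma C1_on_comp_affine a b c d f u v : C1_on c d f ->
  (forall t, a <= t <= b -> c <= u * t + v <= d) ->
  C1_on a b (fun t => f (u * t + v)).
Proof.
intros [f' H] Hm. exists (fun t => u * f' (u * t + v)). intros t Ht.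
destruct (H _ (Hm t Ht)) as [H1 H2]. split.
- apply (is_derive_comp f (fun t => u * t + v) t (f' (u * t + v)) u); [easy|].
  auto_derive; [easy|ring].
- apply (continuous_mult (fun _ => u) (fun t => f' (u * t + v))).
  apply continuous_const.
  apply (continuous_comp (fun t => u * t + v) f'); [|easy].
  apply (ex_derive_continuous (fun t => u * t + v)). auto_derive; easy.
Qed.

Lemma C1_on_ext a b f g : (forall t, f t = g t) -> C1_on a b f -> C1_on a b g.
Proof.
intros E [f' H]. exists f'. intros t Ht. destruct (H t Ht) as [H1 H2]. split; [|easy].
now apply (is_derive_ext f).
Qed.

Lemma C1_on_sin a b : C1_on a b sin.
Proof.
exists cos. intros t _. split.
- auto_derive; [easy|ring].
- apply (ex_derive_continuous cos). auto_derive; easy.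
Qed.

Lemma C1_on_const a b c : C1_on a b (fun _ => c).
Proof.
exists (fun _ => 0). intros t _. split; [|apply continuous_const].
auto_derive; [easy|ring].
Qed.

Lemma C1_on_pow a b n : C1_on a b (fun t => t ^ n).
Proof.
exists (fun t => INR n * t ^ pred n). intros t _. split.
- auto_derive; [easy|ring].
- apply (ex_derive_continuous (fun t => INR n * t ^ pred n)). auto_derive; easy.
Qed.

(** [sin t / t] with the removable singularity at 0 filled in.  As a power series
    in [t ^ 2] it is visibly C1 at 0, and all quotients by sines below are written
    with it. *)
Definition sinc (t : R) : R := PSeries sin_n (t ^ 2).

Lemma sin_n_radius : CV_radius sin_n = p_infty.
Proof.
apply CV_radius_infinite_DAlembert. exact sin_no_R0.
apply is_lim_seq_Reals. exact Alembert_sin.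
Qed.

Lemma sin_sinc t : sin t = t * sinc t.
Proof.
unfold sin, sinc. destruct (exist_sin (Rsqr t)) as [l Hl].
f_equal. symmetry. apply is_series_unique.
apply is_series_Reals in Hl. unfold Rsqr in Hl.
eapply is_series_ext; [|exact Hl].
intros n. simpl. now rewrite Rmult_1_r.
Qed.

Lemma C1_on_sinc a b : C1_on a b sinc.
Proof.
exists (fun t => 2 * t * PSeries (PS_derive sin_n) (t ^ 2)). intros t _. split.
- apply (is_derive_comp (PSeries sin_n) (fun t => t ^ 2) t).
  + apply is_derive_PSeries. now rewrite sin_n_radius.
  + auto_derive; [easy|ring].
- apply (continuous_mult (fun t => 2 * t) (fun t => PSeries (PS_derive sin_n) (t ^ 2))).
  + apply (ex_derive_continuous (fun t => 2 * t)). auto_derive; easy.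
  + apply (continuous_comp (fun t => t ^ 2) (PSeries (PS_derive sin_n))).
    * apply (ex_derive_continuous (fun t => t ^ 2)). auto_derive; easy.
    * apply (ex_derive_continuous (PSeries (PS_derive sin_n))).
      eexists. apply is_derive_PSeries. now rewrite CV_radius_derive, sin_n_radius.
Qed.

Lemma sinc_pos t : 0 <= t < PI -> 0 < sinc t.
Proof.
intros [Ht Hp]. destruct (Req_dec t 0) as [->|Hn].
- unfold sinc. replace (0 ^ 2) with 0 by ring. rewrite PSeries_0.
  unfold sin_n; simpl; lra.
- assert (H : 0 < sin t) by (apply sin_gt_0; lra).
  rewrite sin_sinc in H. apply (Rmult_lt_reg_l t); lra.
Qed.

(** * The Riemann-Lebesgue lemma *)

(** One integration by parts bounds the integral by a constant over the frequency. *)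
Lemma Riemann_Lebesgue a b f w phi : a <= b -> C1_on a b f ->
  is_lim_seq w p_infty ->
  is_lim_seq (fun N => RInt (fun t => f t * sin (w N * t + phi)) a b) 0.
Proof.
intros Hab Hf Hw. assert (Hf' := Hf). destruct Hf' as [f' H].
assert (Hm : Rmin a b = a) by now apply Rmin_left.
assert (HM : Rmax a b = b) by now apply Rmax_right.
assert (Hc : forall w0 t, continuous (fun t => cos (w0 * t + phi)) t).
{ intros w0 t. apply (ex_derive_continuous (fun t => cos (w0 * t + phi))). auto_derive; easy. }
assert (Hi : ex_RInt (fun t => Rabs (f' t)) a b).
{ apply (ex_RInt_continuous (V := R_CompleteNormedModule)). rewrite Hm, HM. intros t Ht.
  apply (continuous_comp f' Rabs). now apply H. apply continuous_Rabs. }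
set (C := Rabs (f b) + Rabs (f a) + RInt (fun t => Rabs (f' t)) a b).
apply is_lim_seq_abs_0.
apply (is_lim_seq_le_le_loc (fun _ => 0) _ (fun N => C * / w N)); cycle 1.
- apply is_lim_seq_const.
- replace (Finite 0) with (Rbar_mult C (Rbar_inv p_infty)).
  2:{ simpl. f_equal; ring. }
  apply is_lim_seq_scal_l. apply is_lim_seq_inv; easy.
- assert (Hw1 : eventually (fun N => 0 < w N)).
  { apply is_lim_seq_spec in Hw. apply (Hw 0). }
  revert Hw1. apply filter_imp. intros N HN. split; [apply Rabs_pos|].
  set (w0 := w N) in *.
  assert (Hex : ex_RInt (fun t => f' t * cos (w0 * t + phi)) a b).
  { apply (ex_RInt_continuous (V := R_CompleteNormedModule)). rewrite Hm, HM. intros t Ht.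
    apply (continuous_mult f' (fun t => cos (w0 * t + phi))). now apply H. apply Hc. }
  assert (HI : is_RInt (fun t => f t * sin (w0 * t + phi)) a b
     (/ w0 * (f a * cos (w0 * a + phi) - f b * cos (w0 * b + phi)
       + RInt (fun t => f' t * cos (w0 * t + phi)) a b))).
  { assert (E := is_RInt_scal_derive_r (V := R_CompleteNormedModule) f
      (fun t => - / w0 * cos (w0 * t + phi)) f' (fun t => sin (w0 * t + phi)) a b
      (- / w0 * RInt (fun t => f' t * cos (w0 * t + phi)) a b)).
    rewrite Hm, HM in E.
    refine (eq_ind _ (fun l => is_RInt _ a b l) (E _ _ _ _ _) _ _).
    - intros t Ht; now apply H.
    - intros t Ht. auto_derive; [easy|]. field. lra.
    - intros t Ht; now apply H.
    - intros t Ht. apply (ex_derive_continuous (fun t => sin (w0 * t + phi))). auto_derive; easy.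
    - apply (is_RInt_ext (fun t => scal (- / w0) (f' t * cos (w0 * t + phi)))).
      { intros t _. unfold scal; simpl; unfold mult; simpl. ring. }
      apply (is_RInt_scal (fun t => f' t * cos (w0 * t + phi))).
      now apply (RInt_correct (V := R_CompleteNormedModule)).
    - unfold minus, plus, opp, scal; simpl; unfold mult; simpl. ring. }
  rewrite (is_RInt_unique _ _ _ _ HI).
  rewrite Rabs_mult, Rmult_comm, (Rabs_pos_eq (/ w0)).
  2:{ left; now apply Rinv_0_lt_compat. }
  apply Rmult_le_compat_r. { left; now apply Rinv_0_lt_compat. }
  assert (Hcos : forall x y, Rabs (x * cos y) <= Rabs x).
  { intros x y. rewrite Rabs_mult. rewrite <- (Rmult_1_r (Rabs x)) at 2.
    apply Rmult_le_compat_l. apply Rabs_pos. apply Rabs_le, COS_bound. }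
  unfold C. eapply Rle_trans; [apply Rabs_triang|]. apply Rplus_le_compat.
  + unfold Rminus. eapply Rle_trans; [apply Rabs_triang|]. rewrite Rabs_Ropp, Rplus_comm.
    apply Rplus_le_compat; apply Hcos.
  + eapply Rle_trans; [apply abs_RInt_le; easy|].
    apply RInt_le; [easy| |easy|].
    * apply (ex_RInt_continuous (V := R_CompleteNormedModule)). rewrite Hm, HM. intros t Ht.
      apply (continuous_comp (fun t => f' t * cos (w0 * t + phi)) Rabs).
      apply (continuous_mult f' (fun t => cos (w0 * t + phi))). now apply H. apply Hc.
      apply continuous_Rabs.
    * intros t _. apply Hcos.
Qed.

(** * Partial fractions of the cotangent *)

(** Coquelicot's generic operations at type [R], turned back into those that
    [ring] and [field] recognize. *)
Ltac real_ops :=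
  repeat match goal with
  | |- context [@minus ?G ?x ?y] => change (@minus G x y) with (Rminus x y)
  | |- context [@plus ?G ?x ?y] => change (@plus G x y) with (Rplus x y)
  | |- context [@opp ?G ?x] => change (@opp G x) with (Ropp x)
  | |- context [@scal ?K ?G ?x ?y] => change (@scal K G x y) with (Rmult x y)
  | |- context [@mult ?G ?x ?y] => change (@mult G x y) with (Rmult x y)
  | |- context [@sum_n ?G ?f ?n] =>
      lazymatch G with R_AbelianMonoid => fail | _ => change (@sum_n G f n) with (@sum_n R_AbelianMonoid f n) end
  | |- context [@sum_n_m ?G ?f ?m ?n] =>
      lazymatch G with R_AbelianMonoid => fail | _ => change (@sum_n_m G f m n) with (@sum_n_m R_AbelianMonoid f m n) end
  end;
  try match goal with |- @eq _ ?x ?y => change (@eq R x y) end.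

Lemma is_RInt_sum_n (f : nat -> R -> R) a b (l : nat -> R) N :
  (forall k, (k <= N)%nat -> is_RInt (f k) a b (l k)) ->
  is_RInt (fun t => sum_n (fun k => f k t) N) a b (sum_n l N).
Proof.
induction N as [|N IH]; intros H.
- rewrite sum_O. apply (is_RInt_ext (f 0%nat)); [|now apply H].
  intros t _. now rewrite sum_O.
- rewrite sum_Sn.
  apply (is_RInt_ext (fun t => plus (sum_n (fun k => f k t) N) (f (S N) t))).
  { intros t _. now rewrite sum_Sn. }
  apply (is_RInt_plus (fun t => sum_n (fun k => f k t) N)); [|now apply H].
  apply IH. intros; apply H; lia.
Qed.

(** The product formula [2 sin x cos y = sin (x + y) + sin (x - y)] makes the sum
    telescope. *)
Lemma Dirichlet_cos t N :
  sin (t / 2) * (1 + 2 * sum_n (fun n => cos (INR (S n) * t)) N) = sin ((INR N + 3 / 2) * t).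
Proof.
assert (P : forall x y, 2 * sin x * cos y = sin (x + y) + sin (x - y)).
{ intros x y. rewrite sin_plus, sin_minus. ring. }
induction N as [|N IH].
- rewrite sum_O, Rmult_plus_distr_l.
  replace (sin (t / 2) * (2 * cos (INR 1 * t))) with (2 * sin (t / 2) * cos (INR 1 * t)) by ring.
  rewrite P. simpl INR.
  replace (t / 2 - 1 * t) with (- (t / 2)) by lra. rewrite sin_neg.
  replace (t / 2 + 1 * t) with ((0 + 3 / 2) * t) by lra. ring.
- rewrite sum_Sn. change plus with Rplus.
  replace (sin (t / 2) * (1 + 2 * (sum_n (fun n => cos (INR (S n) * t)) N + cos (INR (S (S N)) * t))))
   with (sin (t / 2) * (1 + 2 * sum_n (fun n => cos (INR (S n) * t)) N)
     + 2 * sin (t / 2) * cos (INR (S (S N)) * t)) by ring.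
  rewrite IH, P. rewrite !S_INR.
  replace (t / 2 - (INR N + 1 + 1) * t) with (- ((INR N + 3 / 2) * t)) by lra.
  rewrite sin_neg.
  replace (t / 2 + (INR N + 1 + 1) * t) with ((INR N + 1 + 3 / 2) * t) by lra. ring.
Qed.

Lemma sin_INR_PI n : sin (INR n * PI) = 0.
Proof. apply sin_eq_0_1. exists (Z.of_nat n). now rewrite INR_IZR_INZ. Qed.

Lemma is_RInt_cos_cos x n : x - INR n <> 0 -> x + INR n <> 0 ->
  is_RInt (fun t => cos (x * (PI - t)) * cos (INR n * t)) 0 PI
    (sin (x * PI) * (x / (x ^ 2 - INR n ^ 2))).
Proof.
intros H1 H2.
assert (E := is_RInt_derive (V := R_CompleteNormedModule)
  (fun t => / 2 * (- sin (x * PI - (x - INR n) * t) / (x - INR n)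
      - sin (x * PI - (x + INR n) * t) / (x + INR n)))
  (fun t => cos (x * (PI - t)) * cos (INR n * t)) 0 PI).
refine (eq_ind _ (fun l => is_RInt _ _ _ l) (E _ _) _ _).
- intros t _. auto_derive; [easy|].
  replace (x * (PI - t)) with (x * PI - x * t) by ring.
  replace (x * PI + - ((x - INR n) * t)) with ((x * PI - x * t) + INR n * t) by ring.
  replace (x * PI + - ((x + INR n) * t)) with ((x * PI - x * t) - INR n * t) by ring.
  generalize (x * PI - x * t). intros u. rewrite cos_plus, cos_minus. field. split; lra.
- intros t _. apply (ex_derive_continuous (fun t => cos (x * (PI - t)) * cos (INR n * t))).
  auto_derive; easy.
- unfold minus, plus, opp; simpl.
  replace (x * PI - (x - INR n) * PI) with (INR n * PI) by ring.
  replace (x * PI - (x + INR n) * PI) with (- (INR n * PI)) by ring.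
  rewrite sin_neg, sin_INR_PI.
  replace (x * PI - (x - INR n) * 0) with (x * PI) by ring.
  replace (x * PI - (x + INR n) * 0) with (x * PI) by ring.
  field. split; [|lra].
  replace (x ^ 2 - INR n ^ 2) with ((x - INR n) * (x + INR n)) by ring.
  repeat split; auto. nra.
Qed.

Lemma is_RInt_cos_period n : is_RInt (fun t => cos (INR (S n) * t)) 0 PI 0.
Proof.
assert (Hn : INR (S n) <> 0) by now apply not_0_INR.
assert (E := is_RInt_derive (V := R_CompleteNormedModule)
  (fun t => sin (INR (S n) * t) / INR (S n)) (fun t => cos (INR (S n) * t)) 0 PI).
refine (eq_ind _ (fun l => is_RInt _ _ _ l) (E _ _) _ _).
- intros t _. revert Hn. generalize (INR (S n)). intros c Hc. auto_derive; [easy|]. now field.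
- intros t _. apply (ex_derive_continuous (fun t => cos (INR (S n) * t))).
  auto_derive; easy.
- unfold minus, plus, opp; simpl minus. rewrite sin_INR_PI, Rmult_0_r, sin_0.
  revert Hn. generalize (INR (S n)). intros c Hc. unfold minus, plus, opp; simpl. now field.
Qed.

(** Fourier series of [cos (x * (PI - t))] at [t = 0].  Integrating this function
    against the Dirichlet kernel [K N] gives [sin (PI x)] times a partial sum of
    the fractions.  After subtraction of the value [cos (PI x)] at [t = 0], the
    factor [sin (t / 2)] in the denominator of the kernel cancels, and what
    remains is a C1 function [F] times a sine of growing frequency. *)
Lemma cot_expansion x : 0 < x < 1 ->
  is_series (fun k => x ^ 2 / (INR (S k) ^ 2 - x ^ 2))
    ((1 - cos (PI * x) / sinc (PI * x)) / 2).
Proof.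
intros Hx. assert (HP := PI_RGT_0).
assert (Hs : 0 < sin (x * PI)) by (apply sin_gt_0; nra).
assert (HnS : forall n, 1 <= INR (S n)).
{ intros n. rewrite S_INR. assert (H := pos_INR n). lra. }
set (F := fun t => 2 * x * sin (- (x / 2) * t + x * PI) * (sinc (x / 2 * t + 0) * / sinc (1 / 2 * t + 0))).
set (K := fun N t => 1 + 2 * sum_n (fun n => cos (INR (S n) * t)) N).
set (S1 := fun N => 1 / x + 2 * sum_n (fun n => x / (x ^ 2 - INR (S n) ^ 2)) N).
assert (HK : forall N, is_RInt (K N) 0 PI PI).
{ intros N. unfold K.
  assert (E : is_RInt (fun t => plus 1 (scal 2 (sum_n (fun n => cos (INR (S n) * t)) N))) 0 PI
     (plus (scal (PI - 0) 1) (scal 2 (sum_n (fun _ => 0) N)))).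
  { apply (is_RInt_plus (fun _ => 1)).
    - apply (is_RInt_const 0 PI 1).
    - apply (is_RInt_scal (fun t => sum_n (fun n => cos (INR (S n) * t)) N)).
      apply (is_RInt_sum_n (fun n t => cos (INR (S n) * t)) 0 PI (fun _ => 0)).
      intros; apply is_RInt_cos_period. }
  refine (eq_ind _ (fun l => is_RInt _ _ _ l) E _ _).
  rewrite sum_n_const. real_ops. ring. }
assert (HC : forall N, is_RInt (fun t => cos (x * (PI - t)) * K N t) 0 PI (sin (x * PI) * S1 N)).
{ intros N.
  assert (E : is_RInt (fun t => plus (cos (x * (PI - t)) * cos (INR 0 * t))
     (scal 2 (sum_n (fun n => cos (x * (PI - t)) * cos (INR (S n) * t)) N))) 0 PI
     (plus (sin (x * PI) * (x / (x ^ 2 - INR 0 ^ 2)))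
      (scal 2 (sum_n (fun n => sin (x * PI) * (x / (x ^ 2 - INR (S n) ^ 2))) N)))).
  { apply (is_RInt_plus (fun t => cos (x * (PI - t)) * cos (INR 0 * t))).
    - apply is_RInt_cos_cos; simpl; lra.
    - apply (is_RInt_scal (fun t => sum_n (fun n => cos (x * (PI - t)) * cos (INR (S n) * t)) N)).
      apply (is_RInt_sum_n (fun n t => cos (x * (PI - t)) * cos (INR (S n) * t))).
      intros k _. specialize (HnS k). apply is_RInt_cos_cos; lra. }
  eapply is_RInt_ext; [|refine (eq_ind _ (fun l => is_RInt _ _ _ l) E _ _)].
  - intros t _. unfold K.
    rewrite (sum_n_ext _ (fun n => mult (cos (x * (PI - t))) (cos (INR (S n) * t)))) by easy.
    rewrite sum_n_mult_l. change (INR 0) with 0. rewrite Rmult_0_l, cos_0.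
    real_ops. ring.
  - rewrite (sum_n_ext _ (fun n => mult (sin (x * PI)) (x / (x ^ 2 - INR (S n) ^ 2)))) by easy.
    rewrite sum_n_mult_l. unfold S1. real_ops. change (INR 0) with 0. field. lra. }
assert (HF : forall N, RInt (fun t => F t * sin ((INR N + 3 / 2) * t + 0)) 0 PI
   = sin (x * PI) * S1 N - cos (x * PI) * PI).
{ intros N. apply is_RInt_unique.
  assert (E : is_RInt (fun t => minus (cos (x * (PI - t)) * K N t) (scal (cos (x * PI)) (K N t))) 0 PI
    (minus (sin (x * PI) * S1 N) (scal (cos (x * PI)) PI))).
  { apply (is_RInt_minus (fun t => cos (x * (PI - t)) * K N t)); [apply HC|].
    apply (is_RInt_scal (K N)), HK. }
  revert E. apply is_RInt_ext. intros t. rewrite Rmin_left, Rmax_right by lra. intros Ht.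
  unfold F. rewrite !Rplus_0_r, <- Dirichlet_cos. fold (K N t).
  replace (t / 2) with (1 / 2 * t) by lra. rewrite (sin_sinc (1 / 2 * t)).
  assert (H0 : 0 < sinc (1 / 2 * t)) by (apply sinc_pos; lra).
  real_ops.
  (* the factor sin (x t / 2) supplies the sine that cancels the denominator *)
  assert (Hu : cos (x * (PI - t)) = cos (x * PI) + 2 * sin (- (x / 2) * t + x * PI) * sin (x / 2 * t)).
  { set (u := - (x / 2) * t + x * PI). set (v := x / 2 * t).
    replace (x * (PI - t)) with (u - v) by (unfold u, v; field).
    replace (x * PI) with (u + v) by (unfold u, v; field).
    rewrite cos_minus, cos_plus. ring. }
  rewrite Hu, (sin_sinc (x / 2 * t)). field. lra. }
assert (HL : is_lim_seq (fun N => RInt (fun t => F t * sin ((INR N + 3 / 2) * t + 0)) 0 PI) 0).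
{ apply Riemann_Lebesgue.
  - lra.
  - unfold F. apply C1_on_mult; [apply C1_on_mult; [apply C1_on_const|]|].
    (* any segment containing the argument serves; it lies within [0, 4] *)
    + apply (C1_on_comp_affine 0 PI (-10) (10) sin); [apply C1_on_sin|].
      assert (H4 := PI_4). intros t Ht. nra.
    + apply C1_on_mult; [|apply C1_on_inv].
      * apply (C1_on_comp_affine 0 PI 0 PI sinc); [apply C1_on_sinc|]. intros t Ht. nra.
      * apply (C1_on_comp_affine 0 PI 0 PI sinc); [apply C1_on_sinc|]. intros t Ht. nra.
      * intros t Ht. apply Rgt_not_eq, sinc_pos. lra.
  - apply (is_lim_seq_plus _ _ p_infty (3 / 2) p_infty).
    apply is_lim_seq_INR. apply is_lim_seq_const. easy. }
apply (is_lim_seq_ext _ _ _ HF) in HL.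
assert (Hsc : sin (x * PI) = PI * x * sinc (PI * x)) by (rewrite <- sin_sinc; f_equal; ring).
assert (H0 : 0 < sinc (PI * x)) by (apply sinc_pos; nra).
change (is_lim_seq (fun N => sum_n (fun k => x ^ 2 / (INR (S k) ^ 2 - x ^ 2)) N)
  ((1 - cos (PI * x) / sinc (PI * x)) / 2)).
apply (is_lim_seq_ext (fun N => (1 - cos (PI * x) / sinc (PI * x)) / 2
  + - (x / (2 * sin (x * PI))) * (sin (x * PI) * S1 N - cos (x * PI) * PI))).
{ intros N. unfold S1.
  rewrite (sum_n_ext (G := R_Ring) (fun k => x ^ 2 / (INR (S k) ^ 2 - x ^ 2))
    (fun n => mult (- x) (x / (x ^ 2 - INR (S n) ^ 2)))).
  2:{ intros n. specialize (HnS n). real_ops. revert HnS. generalize (INR (S n)). intros c Hc. field. split; nra. }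
  rewrite sum_n_mult_l. rewrite Hsc. replace (cos (x * PI)) with (cos (PI * x)) by (f_equal; ring).
  real_ops. field. lra. }
replace (Finite ((1 - cos (PI * x) / sinc (PI * x)) / 2)) with
 (Rbar_plus ((1 - cos (PI * x) / sinc (PI * x)) / 2) (Rbar_mult (- (x / (2 * sin (x * PI)))) 0)).
2:{ simpl. f_equal. ring. }
apply is_lim_seq_plus'. apply is_lim_seq_const.
now apply (is_lim_seq_scal_l _ _ 0).
Qed.

(** * The zeta series as an integral of the cotangent *)

Lemma is_series_Rmult c (a : nat -> R) l :
  is_series a l -> is_series (fun n => c * a n) (c * l).
Proof. exact (is_series_scal c a l). Qed.

Lemma INR_S_pos n : 0 < INR (S n).
Proof. apply lt_0_INR; lia. Qed.

Lemma is_lim_seq_inv_SS : is_lim_seq (fun n => / INR (S (S n))) 0.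
Proof.
change (Finite 0) with (Rbar_inv p_infty). apply is_lim_seq_inv; [|easy].
assert (H := proj1 (is_lim_seq_incr_n INR 2 p_infty) is_lim_seq_INR).
refine (is_lim_seq_ext _ _ _ _ H). intros n. now rewrite Nat.add_comm.
Qed.

(** Comparison with the telescoping series of [2 / ((n + 1) (n + 2))]. *)
Lemma ex_series_inv_pow s : (2 <= s)%nat -> ex_series (fun n => / INR (S n) ^ s).
Proof.
intros Hs.
apply (ex_series_le (K := R_AbsRing) (V := R_CompleteNormedModule) _ (fun n => 2 * (/ INR (S n) - / INR (S (S n))))).
- intros n. change norm with Rabs. assert (H := INR_S_pos n). assert (H1 := pos_INR n). rewrite Rabs_pos_eq.
  2:{ left. apply Rinv_0_lt_compat, pow_lt, H. }
  apply Rle_trans with (/ INR (S n) ^ 2).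
  + apply Rinv_le_contravar. now apply pow_lt. apply Rle_pow; [|easy].
    rewrite S_INR. lra.
  + rewrite (S_INR (S n)). rewrite S_INR in *. set (c := INR n) in *.
    replace (2 * (/ (c + 1) - / (c + 1 + 1))) with (/ (c + 1) ^ 2 * (2 * (c + 1) / (c + 2))) by (field; lra).
    rewrite <- (Rmult_1_r (/ (c + 1) ^ 2)) at 1. apply Rmult_le_compat_l.
    left. apply Rinv_0_lt_compat, pow_lt; lra.
    apply (Rmult_le_reg_r (c + 2)); [lra|].
    unfold Rdiv. rewrite Rmult_assoc, Rinv_l; lra.
- exists (2 * 1). apply is_series_Rmult.
  change (is_lim_seq (sum_n (fun n => / INR (S n) - / INR (S (S n)))) 1).
  apply (is_lim_seq_ext (fun N => 1 - / INR (S (S N)))).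
  + intros N. induction N as [|N IH].
    * rewrite sum_O. simpl. field.
    * rewrite sum_Sn, <- IH. real_ops. ring.
  + replace (Finite 1) with (Finite (1 - 0)) by (f_equal; ring).
    apply is_lim_seq_minus'. apply is_lim_seq_const.
    exact is_lim_seq_inv_SS.
Qed.

Lemma is_series_zeta s : (2 <= s)%nat -> is_series (fun n => / INR (S n) ^ s) (zeta s).
Proof.
intros Hs. destruct s as [|s]; [lia|]. unfold zeta.
rewrite (Series_ext _ (fun n => / INR (S n) ^ S s)).
- now apply Series_correct, ex_series_inv_pow.
- intros n. rewrite Nat.add_1_r. field. apply pow_nonzero. assert (H := INR_S_pos n). lra.
Qed.

(** With [q = x^2 / (k^2 - x^2)] and [r = x^2 / k^2] one has [q * (1 - r) = r], so
    passing from [q * r ^ N] to [q * r ^ (N + 1)] subtracts [r ^ (N + 1)], whose sum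
    over [k] is [zeta (2 (N + 1)) * x ^ (2 (N + 1))].  The case [N = 0] is the
    expansion of the cotangent; there [zeta 0 = - 1 / 2] provides the constant. *)
Lemma is_series_zeta_remainder x N : 0 < x < 1 ->
  is_series (fun k => x ^ 2 / (INR (S k) ^ 2 - x ^ 2) * (x ^ 2 / INR (S k) ^ 2) ^ N)
    (- (cos (PI * x) / sinc (PI * x)) / 2 - sum_n (fun n => zeta (2 * n) * x ^ (2 * n)) N).
Proof.
intros Hx. induction N as [|N IH].
- rewrite sum_O. simpl zeta.
  assert (E := cot_expansion x Hx).
  refine (eq_ind _ (fun l => is_series _ l) (is_series_ext _ _ _ _ E) _ _).
  + intros n. simpl. ring.
  + simpl. field. apply Rgt_not_eq, sinc_pos. assert (H := PI_RGT_0). nra.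
- assert (E := is_series_Rmult (x ^ (2 * S N)) _ _ (is_series_zeta (2 * S N) ltac:(lia))).
  assert (E' := is_series_minus _ _ _ _ IH E).
  rewrite sum_Sn.
  refine (eq_ind _ (fun l => is_series _ l) (is_series_ext _ _ _ _ E') _ _).
  + intros k. real_ops. rewrite !pow_mult. unfold Rdiv. rewrite !Rpow_mult_distr, !pow_inv.
    assert (H := INR_S_pos k).
    assert (H1 : 1 <= INR (S k)) by (rewrite S_INR; assert (H1 := pos_INR k); lra).
    assert (x ^ 2 < 1) by nra.
    assert (1 <= INR (S k) ^ 2) by nra.
    set (y := x ^ 2) in *. set (c := INR (S k) ^ 2) in *.
    rewrite <- !tech_pow_Rmult. field.
    repeat split; try apply pow_nonzero; lra.
  + real_ops. ring.
Qed.

(** The remainder series has nonnegative terms, each at most [(1 / 16) ^ N] times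
    the corresponding term for [N = 0], since [r <= x ^ 2 <= 1 / 16]; and the sum
    for [N = 0] is at most [1 / 2] because the cotangent is nonnegative. *)
Lemma zeta_partial_bound x N : 0 < x <= 1 / 4 ->
  Rabs (cos (PI * x) / sinc (PI * x) + 2 * sum_n (fun n => zeta (2 * n) * x ^ (2 * n)) N)
    <= (1 / 16) ^ N.
Proof.
intros Hx. assert (HP := PI_RGT_0).
assert (E0 := cot_expansion x ltac:(lra)).
assert (E := is_series_zeta_remainder x N ltac:(lra)).
assert (E1 := is_series_Rmult ((1 / 16) ^ N) _ _ E0).
assert (HC : 0 <= cos (PI * x) / sinc (PI * x)).
{ apply Rdiv_le_0_compat. apply cos_ge_0; nra. apply sinc_pos; nra. }
set (C := cos (PI * x) / sinc (PI * x)) in *.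
set (P := sum_n (fun n => zeta (2 * n) * x ^ (2 * n)) N) in *.
set (a := fun k => x ^ 2 / (INR (S k) ^ 2 - x ^ 2) * (x ^ 2 / INR (S k) ^ 2) ^ N) in *.
assert (Hq : forall k, 0 <= x ^ 2 / (INR (S k) ^ 2 - x ^ 2)).
{ intros k. assert (H1 : 1 <= INR (S k)) by (rewrite S_INR; assert (H1 := pos_INR k); lra).
  apply Rdiv_le_0_compat; nra. }
assert (Hr : forall k, 0 <= x ^ 2 / INR (S k) ^ 2 <= 1 / 16).
{ intros k. assert (H1 : 1 <= INR (S k)) by (rewrite S_INR; assert (H1 := pos_INR k); lra).
  split. apply Rdiv_le_0_compat; nra.
  apply (Rmult_le_reg_r (INR (S k) ^ 2)); [nra|]. unfold Rdiv.
  rewrite (Rmult_assoc (x ^ 2)), Rinv_l; [|nra]. nra. }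
assert (Ha : forall k, 0 <= a k <= (1 / 16) ^ N * (x ^ 2 / (INR (S k) ^ 2 - x ^ 2))).
{ intros k. specialize (Hq k). destruct (Hr k) as [r1 r2]. unfold a. split.
  - apply Rmult_le_pos; [easy|]. now apply pow_le.
  - rewrite Rmult_comm. apply Rmult_le_compat_r; [easy|]. now apply pow_incr. }
assert (U : - C / 2 - P <= (1 / 16) ^ N * ((1 - C) / 2)).
{ rewrite <- (is_series_unique _ _ E), <- (is_series_unique _ _ E1).
  apply Series_le; [exact Ha|]. now exists ((1 / 16) ^ N * ((1 - C) / 2)). }
assert (L : 0 <= - C / 2 - P).
{ rewrite <- (is_series_unique _ _ E).
  apply Rle_trans with (Series (fun _ => 0 * 0)).
  - rewrite Series_scal_l. lra.
  - apply Series_le; [|now exists (- C / 2 - P)].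
    intros k. rewrite Rmult_0_l. split; [lra|apply Ha]. }
assert (0 < (1 / 16) ^ N) by (apply pow_lt; lra).
apply Rabs_le. nra.
Qed.

(** [cos y / sinc y] is [y * cot y], continuous at 0. *)
Definition cot_moment (q : nat) : R :=
  RInt (fun u => u ^ q * (cos (PI * (u / 4)) / sinc (PI * (u / 4)))) 0 1.

Lemma C1_on_pow_inv_sinc q : C1_on 0 1 (fun u => u ^ q * / sinc (PI * (u / 4))).
Proof.
assert (HP := PI_RGT_0).
apply C1_on_mult. apply C1_on_pow. apply C1_on_inv.
- apply (C1_on_ext _ _ (fun u => sinc (PI / 4 * u + 0))).
  + intros u. f_equal. field.
  + apply (C1_on_comp_affine 0 1 0 PI). apply C1_on_sinc. intros; nra.
- intros t Ht. apply Rgt_not_eq, sinc_pos. nra.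
Qed.

Lemma is_RInt_cot_moment q :
  is_RInt (fun u => u ^ q * (cos (PI * (u / 4)) / sinc (PI * (u / 4)))) 0 1 (cot_moment q).
Proof.
apply (RInt_correct (V := R_CompleteNormedModule)).
apply (ex_RInt_continuous (V := R_CompleteNormedModule)).
rewrite Rmin_left, Rmax_right by lra. intros u Hu.
apply (continuous_ext (fun u => (u ^ q * / sinc (PI * (u / 4))) * cos (PI * (u / 4)))).
{ intros v. simpl. unfold Rdiv. ring. }
apply (continuous_mult (fun u => u ^ q * / sinc (PI * (u / 4))) (fun u => cos (PI * (u / 4)))).
- exact (C1_on_continuous _ _ _ _ (C1_on_pow_inv_sinc q) Hu).
- apply (ex_derive_continuous (fun u => cos (PI * (u / 4)))). auto_derive; easy.
Qed.

Lemma is_RInt_pow_unit n : is_RInt (fun u => u ^ n) 0 1 (/ INR (S n)).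
Proof.
assert (Hn := INR_S_pos n).
assert (E := is_RInt_derive (V := R_CompleteNormedModule)
  (fun u => u ^ S n / INR (S n)) (fun u => u ^ n) 0 1).
refine (eq_ind _ (fun l => is_RInt _ _ _ l) (E _ _) _ _).
(* the exponent becomes a variable, so that differentiation does not unfold
   the power *)
- intros t _. revert Hn. change (t ^ n) with (t ^ pred (S n)).
  generalize (S n). intros m Hm. auto_derive; [easy|]. field. lra.
- intros t _. apply (ex_derive_continuous (fun u => u ^ n)). auto_derive; easy.
- real_ops. rewrite pow1, pow_i by lia. field. lra.
Qed.

(** The bound on the partial sums is uniform in [u], so it survives the
    integration against [u ^ q]. *)
Lemma is_series_zeta_moment q :
  is_series (fun n => zeta (2 * n) / (INR (2 * n + S q) * 16 ^ n)) (- cot_moment q / 2).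
Proof.
set (a := fun n => zeta (2 * n) / (INR (2 * n + S q) * 16 ^ n)).
assert (HN : forall N, is_RInt (fun u => u ^ q * (cos (PI * (u / 4)) / sinc (PI * (u / 4))
    + 2 * sum_n (fun n => zeta (2 * n) * (u / 4) ^ (2 * n)) N)) 0 1
    (cot_moment q + 2 * sum_n a N)).
{ intros N.
  assert (E : is_RInt (fun u => sum_n (fun n => scal (zeta (2 * n) / 16 ^ n) (u ^ (2 * n + q))) N) 0 1
     (sum_n (fun n => scal (zeta (2 * n) / 16 ^ n) (/ INR (S (2 * n + q)))) N)).
  { apply (is_RInt_sum_n (fun n u => scal (zeta (2 * n) / 16 ^ n) (u ^ (2 * n + q)))). intros k _.
    apply (is_RInt_scal (fun u => u ^ (2 * k + q))), is_RInt_pow_unit. }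
  assert (E' := is_RInt_plus _ _ _ _ _ _ (is_RInt_cot_moment q) (is_RInt_scal _ _ _ 2 _ E)).
  refine (eq_ind _ (fun l => is_RInt _ _ _ l) (is_RInt_ext _ _ _ _ _ _ E') _ _).
  - intros u _. real_ops. rewrite Rmult_plus_distr_l. f_equal.
    rewrite (sum_n_ext _ (fun n => mult (u ^ q) (zeta (2 * n) * (u / 4) ^ (2 * n)))).
    + rewrite sum_n_mult_l. real_ops. ring.
    + intros n. real_ops. unfold Rdiv at 2.
      rewrite Rpow_mult_distr, pow_add, pow_inv, (pow_mult 4 2 n).
      replace (4 ^ 2) with 16 by ring. unfold Rdiv. ring.
  - real_ops. f_equal. f_equal. apply sum_n_ext. intros n. real_ops. unfold a.
    replace (2 * n + S q)%nat with (S (2 * n + q)) by lia.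
    assert (H := INR_S_pos (2 * n + q)).
    field. split; [apply pow_nonzero|]; lra. }
assert (HB : forall N, Rabs (cot_moment q + 2 * sum_n a N) <= (1 / 16) ^ N).
{ intros N. specialize (HN N).
  assert (Hb : forall u, 0 < u < 1 -> Rabs (u ^ q * (cos (PI * (u / 4)) / sinc (PI * (u / 4))
    + 2 * sum_n (fun n => zeta (2 * n) * (u / 4) ^ (2 * n)) N)) <= (1 / 16) ^ N).
  { intros u Hu. rewrite Rabs_mult, <- (Rmult_1_l ((1 / 16) ^ N)).
    apply Rmult_le_compat; try apply Rabs_pos.
    - rewrite Rabs_pos_eq by (apply pow_le; lra).
      rewrite <- (pow1 q). apply pow_incr; lra.
    - apply zeta_partial_bound. lra. }
  assert (Hc : forall c : R, is_RInt (fun _ => c) 0 1 c).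
  { intros c. assert (E : (1 - 0) * c = c) by ring.
    exact (eq_ind _ (fun l => is_RInt (fun _ => c) 0 1 l) (is_RInt_const 0 1 c) c E). }
  apply Rabs_le. split.
  - apply (is_RInt_le _ _ 0 1 _ _ Rle_0_1 (Hc _) HN). intros u Hu.
    specialize (Hb u Hu). apply Rabs_le_between in Hb. apply Hb.
  - apply (is_RInt_le _ _ 0 1 _ _ Rle_0_1 HN (Hc _)). intros u Hu.
    specialize (Hb u Hu). apply Rabs_le_between in Hb. apply Hb. }
assert (HL : is_lim_seq (fun N => cot_moment q + 2 * sum_n a N) 0).
{ apply is_lim_seq_abs_0.
  apply (is_lim_seq_le_le (fun _ => 0) _ (fun N => (1 / 16) ^ N)).
  - intros N. split; [apply Rabs_pos|apply HB].
  - apply is_lim_seq_const.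
  - apply is_lim_seq_geom. rewrite Rabs_pos_eq; lra. }
change (is_lim_seq (sum_n a) (- cot_moment q / 2)).
apply (is_lim_seq_ext (fun N => - cot_moment q / 2 + / 2 * (cot_moment q + 2 * sum_n a N))).
{ intros N. field. }
replace (Finite (- cot_moment q / 2)) with (Finite (- cot_moment q / 2 + / 2 * 0)) by (f_equal; ring).
apply is_lim_seq_plus'. apply is_lim_seq_const.
now apply (is_lim_seq_scal_l _ (/ 2) 0).
Qed.

(** * The cotangent integral as a sum of sine moments *)

(** The product formula [2 sin x sin y = cos (x - y) - cos (x + y)] makes the sum
    telescope. *)
Lemma Dirichlet_sin t N :
  2 * sin t * sum_n (fun k => sin (2 * INR (S k) * t)) N = cos t - cos ((2 * INR N + 3) * t).
Proof.
assert (P : forall x y, 2 * sin x * sin y = cos (x - y) - cos (x + y)).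
{ intros x y. rewrite cos_plus, cos_minus. ring. }
induction N as [|N IH].
- rewrite sum_O, P. replace (t - 2 * INR 1 * t) with (- t) by (simpl; ring).
  rewrite cos_neg. f_equal. f_equal. simpl; ring.
- rewrite sum_Sn. real_ops. rewrite Rmult_plus_distr_l, IH, P. rewrite !S_INR.
  replace (t - 2 * (INR N + 1 + 1) * t) with (- ((2 * INR N + 3) * t)) by ring.
  rewrite cos_neg.
  replace (t + 2 * (INR N + 1 + 1) * t) with ((2 * (INR N + 1) + 3) * t) by ring. ring.
Qed.

(** Multiplying [Dirichlet_sin] at the angle [PI * u / 4] by
    [u ^ q / sinc (PI * u / 4)] and integrating: the difference between
    [cot_moment q] and [PI / 2] times a partial sum is the integral of a C1 function
    times a cosine of growing frequency. *)
Lemma is_lim_seq_sine_moments q (s : nat -> R) :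
  (forall k, is_RInt (fun u => u ^ S q * sin (PI / 2 * INR (S k) * u)) 0 1 (s k)) ->
  is_series s (2 / PI * cot_moment q).
Proof.
intros Hs. assert (HP := PI_RGT_0).
assert (HI : forall N,
  RInt (fun u => (u ^ q * / sinc (PI * (u / 4))) * sin ((2 * INR N + 3) * (PI / 4) * u + PI / 2)) 0 1
   = cot_moment q - PI / 2 * sum_n s N).
{ intros N. apply is_RInt_unique.
  assert (E := is_RInt_minus _ _ _ _ _ _ (is_RInt_cot_moment q)
    (is_RInt_scal _ _ _ (PI / 2) _ (is_RInt_sum_n
     (fun k u => u ^ S q * sin (PI / 2 * INR (S k) * u)) 0 1 s N (fun k _ => Hs k)))).
  refine (is_RInt_ext _ _ _ _ _ _ E). intros u. rewrite Rmin_left, Rmax_right by lra. intros Hu.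
  assert (H0 : 0 < sinc (PI * (u / 4))) by (apply sinc_pos; nra).
  rewrite (sum_n_ext _ (fun k => mult (u ^ S q) (sin (2 * INR (S k) * (PI * (u / 4)))))).
  2:{ intros k. real_ops. f_equal. f_equal. field. }
  rewrite sum_n_mult_l. real_ops.
  rewrite sin_plus, cos_PI2, sin_PI2, Rmult_0_r, Rplus_0_l, Rmult_1_r.
  replace ((2 * INR N + 3) * (PI / 4) * u) with ((2 * INR N + 3) * (PI * (u / 4))) by field.
  assert (D := Dirichlet_sin (PI * (u / 4)) N). rewrite sin_sinc in D.
  replace (cos ((2 * INR N + 3) * (PI * (u / 4)))) with
    (cos (PI * (u / 4)) - 2 * (PI * (u / 4) * sinc (PI * (u / 4))) *
     sum_n (fun k : nat => sin (2 * INR (S k) * (PI * (u / 4)))) N) by (rewrite D; ring).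
  simpl pow. field. lra. }
assert (HL : is_lim_seq (fun N => RInt (fun u => (u ^ q * / sinc (PI * (u / 4)))
    * sin ((2 * INR N + 3) * (PI / 4) * u + PI / 2)) 0 1) 0).
{ apply (Riemann_Lebesgue 0 1 _ (fun N => (2 * INR N + 3) * (PI / 4))); [lra|apply C1_on_pow_inv_sinc|].
  replace p_infty with (Rbar_mult p_infty (PI / 4)).
  2:{ apply is_Rbar_mult_unique, is_Rbar_mult_p_infty_pos. simpl. lra. }
  apply is_lim_seq_scal_r.
  apply (is_lim_seq_plus _ _ p_infty 3 p_infty); [|apply is_lim_seq_const|easy].
  replace p_infty with (Rbar_mult 2 p_infty).
  2:{ rewrite Rbar_mult_comm. apply is_Rbar_mult_unique, is_Rbar_mult_p_infty_pos. simpl. lra. }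
  apply is_lim_seq_scal_l, is_lim_seq_INR. }
apply (is_lim_seq_ext _ _ _ HI) in HL.
change (is_lim_seq (sum_n s) (2 / PI * cot_moment q)).
apply (is_lim_seq_ext (fun N => 2 / PI * cot_moment q - 2 / PI * (cot_moment q - PI / 2 * sum_n s N))).
{ intros N. field. lra. }
replace (Finite (2 / PI * cot_moment q)) with (Finite (2 / PI * cot_moment q - 2 / PI * 0)) by (f_equal; ring).
apply is_lim_seq_minus'. apply is_lim_seq_const.
now apply (is_lim_seq_scal_l _ (2 / PI) 0).
Qed.

(** * Closed form of the sine moments *)

(** Repeated integration by parts of [u ^ p * sin (b * u)] over [[0, 1]] yields a
    multiple of [cos b], a multiple of [sin b] and, for even [p], a contribution of
    the end point 0; the next three functions are their coefficients. *)
Definition cos_coeff (p : nat) (b : R) : R :=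
  - sum_n (fun j => INR (fact p) * (-1) ^ j / (INR (fact (p - 2 * j)) * b ^ (2 * j + 1))) (p / 2).

Definition sin_coeff (p : nat) (b : R) : R :=
  - sum_n_m (fun j => INR (fact p) * (-1) ^ j / (INR (fact (p + 1 - 2 * j)) * b ^ (2 * j)))
      1 ((p + 1) / 2).

Definition const_coeff (p : nat) (b : R) : R :=
  if Nat.even p then INR (fact p) * (-1) ^ (p / 2) / b ^ (p + 1) else 0.

Lemma fact_INR_neq n : INR (fact n) <> 0.
Proof. apply not_0_INR, fact_neq_0. Qed.

Lemma fact_INR_SS p : INR (fact (S (S p))) = INR (S (S p)) * INR (S p) * INR (fact p).
Proof.
change (fact (S (S p))) with (S (S p) * (S p * fact p))%nat.
rewrite !mult_INR. ring.
Qed.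

Lemma div2_SS p : (S (S p) / 2 = S (p / 2))%nat.
Proof. replace (S (S p)) with (p + 1 * 2)%nat by lia. rewrite Nat.div_add; lia. Qed.

Lemma cos_coeff_SS p b : b <> 0 ->
  cos_coeff (S (S p)) b = - / b - INR (S (S p)) * INR (S p) / b ^ 2 * cos_coeff p b.
Proof.
intros Hb. unfold cos_coeff. rewrite div2_SS. unfold sum_n at 1.
rewrite sum_Sn_m by lia. rewrite <- sum_n_m_S. fold (sum_n (fun n => INR (fact (S (S p))) * (-1) ^ S n / (INR (fact (S (S p) - 2 * S n)) * b ^ (2 * S n + 1))) (p / 2)).
rewrite (sum_n_ext (G := R_Ring) _ (fun j => mult (- (INR (S (S p)) * INR (S p) / b ^ 2)) (INR (fact p) * (-1) ^ j / (INR (fact (p - 2 * j)) * b ^ (2 * j + 1))))).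
- rewrite sum_n_mult_l. real_ops. rewrite Nat.sub_0_r. assert (H := fact_INR_neq (S (S p))).
  simpl pow. field. now split.
- intros j. real_ops. replace (S (S p) - 2 * S j)%nat with (p - 2 * j)%nat by lia.
  replace (2 * S j + 1)%nat with (2 + (2 * j + 1))%nat by lia.
  rewrite (pow_add b 2), fact_INR_SS. simpl ((-1) ^ S j).
  assert (H := fact_INR_neq (p - 2 * j)). field. repeat split; try easy; now apply pow_nonzero.
Qed.

Lemma sin_coeff_SS p b : b <> 0 ->
  sin_coeff (S (S p)) b = INR (S (S p)) / b ^ 2 - INR (S (S p)) * INR (S p) / b ^ 2 * sin_coeff p b.
Proof.
intros Hb. unfold sin_coeff. change (S (S p) + 1)%nat with (S (S (p + 1))). rewrite div2_SS.
rewrite sum_Sn_m by lia. rewrite <- sum_n_m_S.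
rewrite (sum_n_m_ext (G := R_Ring) _ (fun j => mult (- (INR (S (S p)) * INR (S p) / b ^ 2)) (INR (fact p) * (-1) ^ j / (INR (fact (p + 1 - 2 * j)) * b ^ (2 * j))))).
- rewrite sum_n_m_mult_l. real_ops.
  replace (S (S (p + 1)) - 2 * 1)%nat with (S p) by lia.
  assert (H := fact_INR_neq (S p)).
  change (fact (S (S p))) with (S (S p) * fact (S p))%nat. rewrite mult_INR.
  change (2 * 1)%nat with 2%nat. change ((-1) ^ 1) with (-1 * 1).
  set (f := INR (fact (S p))) in *. set (s := INR (S (S p))). field. now split.
- intros j. real_ops. replace (S (S (p + 1)) - 2 * S j)%nat with (p + 1 - 2 * j)%nat by lia.
  replace (2 * S j)%nat with (2 + 2 * j)%nat by lia.
  rewrite (pow_add b 2), fact_INR_SS. change ((-1) ^ S j) with (-1 * (-1) ^ j).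
  assert (H := fact_INR_neq (p + 1 - 2 * j)). field. repeat split; try easy; now apply pow_nonzero.
Qed.

Lemma const_coeff_SS p b : b <> 0 ->
  const_coeff (S (S p)) b = - (INR (S (S p)) * INR (S p) / b ^ 2) * const_coeff p b.
Proof.
intros Hb. unfold const_coeff. simpl Nat.even. destruct (Nat.even p); [|ring].
rewrite div2_SS, fact_INR_SS. change (S (S p) + 1)%nat with (2 + (p + 1))%nat.
rewrite (pow_add b 2). change ((-1) ^ S (p / 2)) with (-1 * (-1) ^ (p / 2)).
field. split; [now apply pow_nonzero|easy].
Qed.

Definition sine_moment (p : nat) (b : R) : R :=
  cos b * cos_coeff p b + sin b * sin_coeff p b + const_coeff p b.

(** Two integrations by parts relate the exponents [p + 2] and [p] by the recursion
    that the three coefficients satisfy.  The pair of consecutive exponents in the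
    induction hypothesis serves the step by two. *)
Lemma is_RInt_sine_moment b : b <> 0 -> forall p,
  is_RInt (fun u => u ^ p * sin (b * u)) 0 1 (sine_moment p b).
Proof.
intros Hb.
assert (D : forall f g l, (forall u, is_derive g u (f u)) ->
   (forall u : R, continuous f u) -> g 1 - g 0 = l -> is_RInt f 0 1 l).
{ intros f g l H1 H2 <-. apply (is_RInt_derive (V := R_CompleteNormedModule) g f); auto. }
assert (H : forall p, is_RInt (fun u => u ^ p * sin (b * u)) 0 1 (sine_moment p b)
   /\ is_RInt (fun u => u ^ S p * sin (b * u)) 0 1 (sine_moment (S p) b)).
2:{ intros p. exact (proj1 (H p)). }
induction p as [|p [IH1 IH2]].
- split.
  + apply (D _ (fun u => - cos (b * u) / b)).
    * intros u. auto_derive; [easy|]. field. easy.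
    * intros u. apply (ex_derive_continuous (fun u => u ^ 0 * sin (b * u))). auto_derive; easy.
    * unfold sine_moment, cos_coeff, sin_coeff, const_coeff. simpl.
      rewrite sum_O. rewrite sum_n_m_zero by lia. change (@zero _) with 0.
      rewrite Rmult_1_r, Rmult_0_r, cos_0. simpl. field. easy.
  + apply (D _ (fun u => - u * cos (b * u) / b + sin (b * u) / b ^ 2)).
    * intros u. auto_derive; [easy|]. field. easy.
    * intros u. apply (ex_derive_continuous (fun u => u ^ 1 * sin (b * u))). auto_derive; easy.
    * unfold sine_moment, cos_coeff, sin_coeff, const_coeff. simpl.
      rewrite sum_O, sum_n_n.
      rewrite Rmult_1_r, Rmult_0_r, sin_0. simpl. field. easy.
- split; [exact IH2|].
  set (c := INR (S (S p)) * INR (S p) / b ^ 2).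
  (* this combination has an elementary antiderivative, the boundary terms of
     the two integrations by parts *)
  assert (E : is_RInt (fun u => u ^ S (S p) * sin (b * u) + c * (u ^ p * sin (b * u))) 0 1
     (- cos b / b + INR (S (S p)) * sin b / b ^ 2)).
  { apply (D _ (fun u => - u ^ S (S p) * cos (b * u) / b + INR (S (S p)) * u ^ S p * sin (b * u) / b ^ 2)).
    (* the exponents become variables, so that differentiation does not unfold
       the powers *)
    - intros u. change (u ^ p) with (u ^ pred (S p)).
      change (u ^ S p) with (u ^ pred (S (S p))). unfold c.
      assert (G : forall n m, n = S m -> is_derive (fun u => - u ^ n * cos (b * u) / b + INR n * u ^ m * sin (b * u) / b ^ 2) u (u ^ n * sin (b * u) + INR n * INR m / b ^ 2 * (u ^ pred m * sin (b * u)))).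
      { intros n m Hnm. assert (Hm : pred n = m) by lia. auto_derive; [easy|]. rewrite Hm. field. easy. }
      now apply G.
    - intros u. apply (ex_derive_continuous (fun u => u ^ S (S p) * sin (b * u) + c * (u ^ p * sin (b * u)))).
      auto_derive; easy.
    - rewrite !pow1, !pow_i by lia. rewrite Rmult_1_r. field. easy. }
  assert (E' := is_RInt_minus _ _ _ _ _ _ E (is_RInt_scal _ _ _ c _ IH1)).
  refine (eq_ind _ (fun l => is_RInt _ _ _ l) (is_RInt_ext _ _ _ _ _ _ E') _ _).
  + intros u _. real_ops. ring.
  + real_ops. unfold sine_moment. rewrite cos_coeff_SS, sin_coeff_SS, const_coeff_SS by easy.
    fold c. field. easy.
Qed.

(** * Alternating zeta series *)

Lemma is_series_pairs (a : nat -> R) (l : R) :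
  is_series a l -> is_series (fun m => a (2 * m)%nat + a (2 * m + 1)%nat) l.
Proof.
intros H.
change (is_lim_seq (sum_n (fun m => a (2 * m)%nat + a (2 * m + 1)%nat)) l).
apply (is_lim_seq_ext (fun N => sum_n a (2 * N + 1))).
- induction n as [|n IH].
  + simpl. now rewrite sum_Sn, !sum_O.
  + rewrite sum_Sn, <- IH. replace (2 * S n + 1)%nat with (S (S (2 * n + 1))) by lia.
    rewrite !sum_Sn. replace (S (S (2 * n + 1))) with (2 * S n + 1)%nat by lia.
    replace (S (2 * n + 1)) with (2 * S n)%nat by lia. real_ops. ring.
- apply (is_lim_seq_subseq (sum_n a) l (fun N => (2 * N + 1)%nat)); [|exact H].
  apply eventually_subseq. intros n. lia.
Qed.

Lemma is_series_sum_n_m (a : nat -> nat -> R) (l : nat -> R) m n :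
  (forall j, (m <= j)%nat -> is_series (a j) (l j)) ->
  is_series (fun k => sum_n_m (fun j => a j k) m n) (sum_n_m l m n).
Proof.
intros H. induction n as [|n IH].
- destruct m as [|m].
  + rewrite sum_n_n. apply (is_series_ext (a 0%nat)); [|now apply H].
    intros k. now rewrite sum_n_n.
  + rewrite sum_n_m_zero by lia.
    assert (E := is_series_Rmult 0 _ _ (H (S m) (le_n _))). rewrite Rmult_0_l in E.
    refine (is_series_ext _ _ _ _ E).
    intros k. rewrite sum_n_m_zero by lia. apply Rmult_0_l.
- destruct (le_lt_dec m (S n)) as [Hm|Hm].
  + rewrite sum_n_Sm by easy.
    apply (is_series_ext (fun k => plus (sum_n_m (fun j => a j k) m n) (a (S n) k))).
    * intros k. now rewrite sum_n_Sm.
    * apply (is_series_plus (fun k => sum_n_m (fun j => a j k) m n)); [exact IH|now apply H].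
  + rewrite sum_n_m_zero in IH |- * by lia.
    apply (is_series_ext (fun k => sum_n_m (fun j => a j k) m n)); [|exact IH].
    intros k. now rewrite !sum_n_m_zero by lia.
Qed.

(** The remainder of the geometric sum for [1 / (1 + x)] integrates to at most
    [1 / (N + 2)]. *)
Lemma is_series_ln2 : is_series (fun m => (-1) ^ m / INR (S m)) (ln 2).
Proof.
assert (Hl : is_RInt (fun x => / (1 + x)) 0 1 (ln 2)).
{ assert (E := is_RInt_derive (V := R_CompleteNormedModule) (fun x => ln (1 + x)) (fun x => / (1 + x)) 0 1).
  rewrite Rmin_left, Rmax_right in E by lra.
  refine (eq_ind _ (fun l => is_RInt _ _ _ l) (E _ _) _ _).
  - intros x Hx. auto_derive; [lra|]. field. lra.
  - intros x Hx. apply (ex_derive_continuous (fun x => / (1 + x))). auto_derive; lra.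
  - real_ops. replace (1 + 0) with 1 by ring. rewrite ln_1. replace (1 + 1) with 2 by ring. ring. }
(* the remainder of the geometric sum, with its sign *)
assert (HI : forall N, is_RInt (fun x => - (- x) ^ S N / (1 + x)) 0 1
    (sum_n (fun m => (-1) ^ m / INR (S m)) N - ln 2)).
{ intros N.
  assert (E : is_RInt (fun x => sum_n (fun m => (-1) ^ m * x ^ m) N) 0 1
    (sum_n (fun m => (-1) ^ m * / INR (S m)) N)).
  { apply (is_RInt_sum_n (fun m x => (-1) ^ m * x ^ m)). intros m _.
    apply (is_RInt_scal (fun x => x ^ m)), is_RInt_pow_unit. }
  refine (is_RInt_ext _ _ _ _ _ _ (is_RInt_minus _ _ _ _ _ _ E Hl)).
  intros x. rewrite Rmin_left, Rmax_right by lra. intros Hx. real_ops.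
  assert (G : sum_n (fun m => (-1) ^ m * x ^ m) N = / (1 + x) - (- x) ^ S N / (1 + x)).
  { replace (- x) with (-1 * x) by ring. rewrite Rpow_mult_distr. clear - Hx.
    induction N as [|N IH].
    - rewrite sum_O. simpl. field. lra.
    - rewrite sum_Sn, IH. real_ops. simpl pow. field. lra. }
  rewrite G. field. lra. }
assert (HB : forall N, Rabs (sum_n (fun m => (-1) ^ m / INR (S m)) N - ln 2) <= / INR (S (S N))).
{ intros N. specialize (HI N).
  assert (Hb : forall x, 0 < x < 1 -> Rabs (- (- x) ^ S N / (1 + x)) <= x ^ S N).
  { intros x Hx. unfold Rdiv. rewrite Rabs_mult, Rabs_Ropp, <- RPow_abs, Rabs_Ropp.
    rewrite (Rabs_pos_eq x) by lra. rewrite Rabs_pos_eq.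
    2:{ left. apply Rinv_0_lt_compat. lra. }
    rewrite <- (Rmult_1_r (x ^ S N)) at 2. apply Rmult_le_compat_l. apply pow_le; lra.
    rewrite <- Rinv_1. apply Rinv_le_contravar; lra. }
  assert (HP := is_RInt_pow_unit (S N)).
  apply Rabs_le. split.
  - apply (is_RInt_le _ _ 0 1 _ _ Rle_0_1 (is_RInt_opp _ _ _ _ HP) HI). intros x Hx.
    specialize (Hb x Hx). apply Rabs_le_between in Hb. apply Hb.
  - apply (is_RInt_le _ _ 0 1 _ _ Rle_0_1 HI HP). intros x Hx.
    specialize (Hb x Hx). apply Rabs_le_between in Hb. apply Hb. }
change (is_lim_seq (sum_n (fun m => (-1) ^ m / INR (S m))) (ln 2)).
apply is_lim_seq_ext with (u := fun N => (sum_n (fun m => (-1) ^ m / INR (S m)) N - ln 2) + ln 2).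
{ intros N. ring. }
replace (Finite (ln 2)) with (Finite (0 + ln 2)) by (f_equal; ring).
apply is_lim_seq_plus'; [|apply is_lim_seq_const].
apply is_lim_seq_abs_0.
apply (is_lim_seq_le_le (fun _ => 0) _ (fun N => / INR (S (S N)))).
- intros N. split; [apply Rabs_pos|apply HB].
- apply is_lim_seq_const.
- exact is_lim_seq_inv_SS.
Qed.

(** Changing the sign of the terms with even denominator subtracts twice their sum
    [zeta s / 2 ^ s].  The comparison is made on pairs of consecutive terms, the
    series being known to converge absolutely. *)
Lemma is_series_eta s : (2 <= s)%nat ->
  is_series (fun m => (-1) ^ m / INR (S m) ^ s) ((1 - 2 / 2 ^ s) * zeta s).
Proof.
intros Hs. assert (Hz := is_series_zeta s Hs).
assert (Hex : ex_series (fun m => (-1) ^ m / INR (S m) ^ s)).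
{ apply (ex_series_le (K := R_AbsRing) (V := R_CompleteNormedModule) _ (fun n => / INR (S n) ^ s)).
  - intros m. change norm with Rabs. assert (H := pow_lt _ s (INR_S_pos m)). unfold Rdiv.
    rewrite Rabs_mult, pow_1_abs, Rmult_1_l, Rabs_pos_eq; [lra|].
    left. now apply Rinv_0_lt_compat.
  - now apply ex_series_inv_pow. }
apply Series_correct in Hex.
assert (Hp := is_series_pairs _ _ Hex).
assert (Hzp := is_series_pairs _ _ Hz).
assert (Hd := is_series_minus _ _ _ _ Hzp (is_series_Rmult (2 / 2 ^ s) _ _ Hz)).
replace ((1 - 2 / 2 ^ s) * zeta s) with (Series (fun m => (-1) ^ m / INR (S m) ^ s)); [exact Hex|].
rewrite <- (is_series_unique _ _ Hp).
transitivity (zeta s - 2 / 2 ^ s * zeta s); [|ring].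
etransitivity; [|exact (is_series_unique _ _ Hd)].
apply Series_ext. intros m. real_ops.
rewrite pow_add, pow_mult. replace ((-1) ^ 2) with 1 by ring. rewrite pow1.
replace (INR (S (2 * m + 1))) with (2 * INR (S m)).
2:{ replace (S (2 * m + 1)) with (2 * S m)%nat by lia. rewrite mult_INR. reflexivity. }
rewrite Rpow_mult_distr.
assert (H1 := pow_lt _ s (INR_S_pos m)). assert (H2 := pow_lt 2 s ltac:(lra)).
assert (H3 := pow_lt _ s (INR_S_pos (2 * m))).
field. lra.
Qed.

(** * Summation of the sine moments *)

(** The Dirichlet eta function at [2 j + 1], where [j = 0] falls on the pole of
    [zeta]. *)
Definition eta_odd (j : nat) : R :=
  match j with
  | O => ln 2
  | _ => (1 - 2 / 2 ^ (2 * j + 1)) * zeta (2 * j + 1)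
  end.

Lemma is_series_eta_odd j :
  is_series (fun m => (-1) ^ m / INR (S m) ^ (2 * j + 1)) (eta_odd j).
Proof.
destruct j as [|j].
- apply (is_series_ext (fun m => (-1) ^ m / INR (S m))); [|exact is_series_ln2].
  intros m. simpl pow. now rewrite Rmult_1_r.
- apply is_series_eta. lia.
Qed.

Lemma is_series_beta s : (2 <= s)%nat ->
  is_series (fun n => (-1) ^ n / INR (2 * n + 1) ^ s) (beta s).
Proof.
intros Hs. apply Series_correct.
apply (ex_series_le (K := R_AbsRing) (V := R_CompleteNormedModule) _ (fun n => / INR (S n) ^ s)).
- intros m. change norm with Rabs. assert (H := INR_S_pos m).
  assert (H1 : INR (S m) <= INR (2 * m + 1)) by (apply le_INR; lia).
  unfold Rdiv. rewrite Rabs_mult, pow_1_abs, Rmult_1_l, Rabs_pos_eq.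
  + apply Rinv_le_contravar. now apply pow_lt. apply pow_incr. lra.
  + left. apply Rinv_0_lt_compat, pow_lt. lra.
- now apply ex_series_inv_pow.
Qed.

Lemma cos_INR_PI m : cos (INR m * PI) = (-1) ^ m.
Proof.
induction m as [|m IH].
- simpl. rewrite Rmult_0_l. apply cos_0.
- rewrite S_INR, Rmult_plus_distr_r, Rmult_1_l, neg_cos, IH. simpl. ring.
Qed.

Lemma sine_moment_odd p m :
  sine_moment p (PI / 2 * INR (2 * m + 1)) =
    (-1) ^ m * sin_coeff p (PI / 2 * INR (2 * m + 1))
    + const_coeff p (PI / 2 * INR (2 * m + 1)).
Proof.
unfold sine_moment.
assert (E : PI / 2 * INR (2 * m + 1) = INR m * PI + PI / 2).
{ rewrite plus_INR, mult_INR. simpl. field. }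
assert (Ec : cos (PI / 2 * INR (2 * m + 1)) = 0).
{ rewrite E, cos_plus, cos_PI2, sin_PI2, sin_INR_PI. ring. }
assert (Es : sin (PI / 2 * INR (2 * m + 1)) = (-1) ^ m).
{ rewrite E, sin_plus, cos_PI2, sin_PI2, sin_INR_PI, cos_INR_PI. ring. }
rewrite Ec, Es. ring.
Qed.

Lemma sine_moment_even p m :
  sine_moment p (PI / 2 * INR (2 * m + 2)) =
    - (-1) ^ m * cos_coeff p (PI * INR (S m))
    + const_coeff p (PI / 2 * INR (2 * m + 2)).
Proof.
unfold sine_moment.
assert (E : PI / 2 * INR (2 * m + 2) = PI * INR (S m)).
{ rewrite S_INR, plus_INR, mult_INR. simpl. field. }
rewrite E, (Rmult_comm PI), sin_INR_PI, cos_INR_PI. simpl pow. ring.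
Qed.

Lemma is_series_cos_part p :
  is_series (fun m => - (-1) ^ m * cos_coeff p (PI * INR (S m)))
    (sum_n (fun j => INR (fact p) * (-1) ^ j / (INR (fact (p - 2 * j)) * PI ^ (2 * j + 1)) * eta_odd j) (p / 2)).
Proof.
assert (HP := PI_RGT_0).
unfold sum_n.
assert (E := is_series_sum_n_m (fun j m =>
   INR (fact p) * (-1) ^ j / (INR (fact (p - 2 * j)) * PI ^ (2 * j + 1)) * ((-1) ^ m / INR (S m) ^ (2 * j + 1)))
  _ 0 (p / 2) (fun j _ => is_series_Rmult _ _ _ (is_series_eta_odd j))).
refine (is_series_ext _ _ _ _ E).
intros m. unfold cos_coeff, sum_n.
match goal with |- _ = - ?a * - ?b => replace (- a * - b) with (a * b) by ring end.
rewrite <- (sum_n_m_mult_l (K := R_Ring)). apply sum_n_m_ext. intros j. real_ops.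
assert (H := INR_S_pos m). assert (H1 := fact_INR_neq (p - 2 * j)).
rewrite Rpow_mult_distr. field. repeat split; try easy; apply pow_nonzero; lra.
Qed.

Lemma is_series_sin_part p :
  is_series (fun m => (-1) ^ m * sin_coeff p (PI / 2 * INR (2 * m + 1)))
    (sum_n_m (fun j => - (INR (fact p) * (-1) ^ j / (INR (fact (p + 1 - 2 * j)) * (PI / 2) ^ (2 * j))) * beta (2 * j)) 1 ((p + 1) / 2)).
Proof.
assert (HP := PI_RGT_0).
assert (E := is_series_sum_n_m (fun j m =>
   - (INR (fact p) * (-1) ^ j / (INR (fact (p + 1 - 2 * j)) * (PI / 2) ^ (2 * j))) * ((-1) ^ m / INR (2 * m + 1) ^ (2 * j)))
  _ 1 ((p + 1) / 2) (fun j Hj => is_series_Rmult _ _ _ (is_series_beta (2 * j) ltac:(lia)))).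
refine (is_series_ext _ _ _ _ E).
intros m. unfold sin_coeff.
match goal with |- _ = ?a * - ?b => replace (a * - b) with ((- a) * b) by ring end.
rewrite <- (sum_n_m_mult_l (K := R_Ring)). apply sum_n_m_ext. intros j. real_ops.
replace (2 * m + 1)%nat with (S (2 * m)) by lia.
assert (H := INR_S_pos (2 * m)). assert (H1 := fact_INR_neq (p + 1 - 2 * j)).
rewrite (Rpow_mult_distr (PI / 2)). field. repeat split; try easy; apply pow_nonzero; lra.
Qed.

Lemma is_series_const_part p : (1 <= p)%nat ->
  is_series (fun k => const_coeff p (PI / 2 * INR (S k)))
    (if Nat.even p then INR (fact p) * (-1) ^ (p / 2) / (PI / 2) ^ (p + 1) * zeta (p + 1) else 0).
Proof.
intros Hp. assert (HP := PI_RGT_0). unfold const_coeff. destruct (Nat.even p).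
- refine (is_series_ext _ _ _ _ (is_series_Rmult _ _ _ (is_series_zeta (p + 1) ltac:(lia)))).
  intros k. real_ops. assert (H := INR_S_pos k).
  rewrite (Rpow_mult_distr (PI / 2)). field. repeat split; apply pow_nonzero; lra.
- assert (E := is_series_Rmult 0 _ _ (is_series_zeta 2 (le_n _))). rewrite Rmult_0_l in E.
  refine (is_series_ext _ _ _ _ E). intros k. apply Rmult_0_l.
Qed.

(** Grouped in consecutive pairs, the terms split into three convergent series.
    The hypothesis that the ungrouped series converges makes the grouped sum equal
    to [l]. *)
Lemma sum_sine_moments p l : (1 <= p)%nat ->
  is_series (fun k => sine_moment p (PI / 2 * INR (S k))) l ->
  l = sum_n (fun j => INR (fact p) * (-1) ^ j / (INR (fact (p - 2 * j)) * PI ^ (2 * j + 1)) * eta_odd j) (p / 2)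
    + sum_n_m (fun j => - (INR (fact p) * (-1) ^ j / (INR (fact (p + 1 - 2 * j)) * (PI / 2) ^ (2 * j))) * beta (2 * j)) 1 ((p + 1) / 2)
    + (if Nat.even p then INR (fact p) * (-1) ^ (p / 2) / (PI / 2) ^ (p + 1) * zeta (p + 1) else 0).
Proof.
intros Hp Hl.
assert (E := is_series_plus _ _ _ _
  (is_series_plus _ _ _ _ (is_series_cos_part p) (is_series_sin_part p))
  (is_series_pairs _ _ (is_series_const_part p Hp))).
apply is_series_pairs in Hl.
rewrite <- (is_series_unique _ _ Hl). apply is_series_unique.
refine (is_series_ext _ _ _ _ E). intros m. real_ops.
replace (S (2 * m)) with (2 * m + 1)%nat by lia.
replace (S (2 * m + 1)) with (2 * m + 2)%nat by lia.
rewrite sine_moment_odd, sine_moment_even. ring.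
Qed.

Theorem mainTheorem4 (p : nat) (hp : (1 <= p)%nat) :
  ex_series (fun n : nat => zeta (2 * n) / (INR (2 * n + p) * 16 ^ n)) /\
  -2 * Series (fun n : nat => zeta (2 * n) / (INR (2 * n + p) * 16 ^ n)) =
    1 / 2 * ln 2
    + 1 / 2 * sum_n_m (fun k : nat =>
        INR (fact p) * (-1) ^ k * (4 ^ k - 1) * zeta (2 * k + 1)
        / (INR (fact (p - 2 * k)) * (2 * PI) ^ (2 * k))) 1 (p / 2)
    - PI / 2 * sum_n_m (fun k : nat =>
        INR (fact p) * (-4) ^ k * beta (2 * k)
        / (INR (fact (p + 1 - 2 * k)) * PI ^ (2 * k))) 1 ((p + 1) / 2)
    + (if Nat.even p
       then INR (fact p) * (-1) ^ (p / 2) * 2 ^ p * zeta (p + 1) / PI ^ p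
       else 0).
Proof.
assert (HP := PI_RGT_0).
destruct p as [|q]; [lia|].
assert (H := is_series_zeta_moment q). split; [now exists (- cot_moment q / 2)|].
rewrite (is_series_unique _ _ H).
assert (Hb : forall k, PI / 2 * INR (S k) <> 0).
{ intros k. assert (H1 := INR_S_pos k). apply Rgt_not_eq. nra. }
assert (HL := sum_sine_moments (S q) _ hp (is_lim_seq_sine_moments q _
  (fun k => is_RInt_sine_moment _ (Hb k) (S q)))).
replace (-2 * (- cot_moment q / 2)) with (PI / 2 * (2 / PI * cot_moment q)) by (field; lra).
rewrite HL. clear H HL Hb. set (p := S q) in *.
rewrite !Rmult_plus_distr_l.
f_equal; [unfold Rminus; f_equal|].
- unfold sum_n. rewrite sum_Sn_m by lia. real_ops. rewrite Rmult_plus_distr_l. f_equal.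
  + rewrite Nat.sub_0_r. simpl. assert (H := fact_INR_neq p). field. split; lra || easy.
  + rewrite <- !(sum_n_m_mult_l (K := R_Ring)).
    apply (sum_n_m_ext_loc (G := R_Ring)). intros j [Hj _]. real_ops. destruct j as [|j]; [lia|].
    unfold eta_odd. set (i := S j). assert (H := fact_INR_neq (p - 2 * i)).
    rewrite (Rpow_mult_distr 2), !(pow_add _ (2 * i) 1), !(pow_mult 2 2).
    replace (2 ^ 2) with 4 by ring. simpl (_ ^ 1).
    field. repeat split; try easy; try apply pow_nonzero; lra.
- rewrite Ropp_mult_distr_l, <- !(sum_n_m_mult_l (K := R_Ring)).
  apply (sum_n_m_ext (G := R_Ring)). intros j. real_ops.
  assert (H := fact_INR_neq (p + 1 - 2 * j)).
  replace (-4) with (-1 * 4) by ring. unfold Rdiv at 3.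
  rewrite !Rpow_mult_distr, pow_inv, (pow_mult 2 2). replace (2 ^ 2) with 4 by ring.
  field. repeat split; try easy; apply pow_nonzero; lra.
- destruct (Nat.even p); [|ring].
  unfold Rdiv at 3. rewrite Rpow_mult_distr, pow_inv, (pow_add PI), (pow_add 2). simpl (_ ^ 1).
  field. repeat split; try apply pow_nonzero; lra.
Qed.
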